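(* Let $\alpha=\sum_{n\ge 1}\alpha_n t^{-n}\in\mathbb{F}_2((t^{-1}))$ be the Laurent series whose coefficient sequence is the Thue–Morse sequence. Then $$\lim_{d\to\infty}\ \liminf_{j\to\infty}\ \lim_{k\to\infty}\ e_{t^j\alpha}(d,k)=\frac23 .$$
   Context: Thue–Morse sequence: let $\mu$ be the substitution on the two letters $\mathbf a,\mathbf b$ given by $\mu(\mathbf a)=\mathbf a\mathbf b$, $\mu(\mathbf b)=\mathbf b\mathbf a$, extended to words by concatenation, and let $\tau(\mathbf a)=0$, $\tau(\mathbf b)=1$ (applied letter by letter). For every $l'\le l$ the first $2^{l'}$ letters of $\mu^l(\mathbf a)$ do not depend on $l$, so the limit word $\mu^\infty(\mathbf a)$ is well defined; $(\alpha_n)_{n\ge1}=\tau(\mu^\infty(\mathbf a))=0,1,1,0,1,0,0,1,\dots\in\mathbb{F}_2^{\mathbb N}$. The series $\alpha$ is irrational (it is quadratic over $\mathbb{F}_2(t)$). Continued fractions: every $\theta\in\mathbb{F}_q((t^{-1}))$ has a unique continued fraction expansion $\theta=[a_0;a_1,a_2,\dots]$ with $a_k\in\mathbb{F}_q[t]$ for $k\ge 0$ and $\deg a_k\ge1$ for $k\ge1$. Put $d_k(\theta)=\deg a_k$ for $k\ge 1$. Mass: for $d>0$ and $k\ge1$, the mass of $\theta$ which lies above $d$ up to the $k$-th partial quotient is $$e_\theta(d,k)=\frac{\sum_{k'=1}^{k}\max\{d_{k'}(\theta)-d,0\}}{\sum_{k'=1}^{k}d_{k'}(\theta)} .$$ 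*)

(* Defs.v *)
From HB Require Import structures.
From mathcomp Require Import all_boot all_order all_algebra.
From mathcomp Require Import all_classical all_reals all_analysis.
From mathcomp Require Import zify.

Set Implicit Arguments.
Unset Strict Implicit.
Unset Printing Implicit Defensive.

Import Order.TTheory GRing.Theory Num.Theory.
Import numFieldNormedType.Exports.

Local Open Scope ring_scope.

(* A Laurent series in t^-1 over F is given by its coefficients: [lcoef f n] is
   the coefficient of t^n, and it vanishes for all large n. *)
Record laurent (F : fieldType) := Laurent {
  lcoef :> int -> F;
  laurentP : exists N : int, forall n, N < n -> lcoef n = 0 }.

HB.instance Definition _ (F : fieldType) := gen_eqMixin (laurent F).
HB.instance Definition _ (F : fieldType) := gen_choiceMixin (laurent F).

Section LaurentField.
Context {F : fieldType}.
Implicit Types (f g h : laurent F) (u v : int -> F) (n N M : int).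

Lemma laurent_eq f g : lcoef f =1 lcoef g -> f = g.
Proof.
case: f g => [u Pu] [v Pv] /= /funext uv; case: _ / uv in Pv *.
by congr Laurent; exact: Prop_irrelevance.
Qed.

Definition lbound f : int := sval (cid (laurentP f)).

Lemma lboundP f n : lbound f < n -> f n = 0.
Proof. by rewrite /lbound; case: cid => N /= + Nn; apply. Qed.

Fact lzero_subproof : exists N : int, forall n, N < n -> (fun=> 0 : F) n = 0.
Proof. by exists 0. Qed.
Definition lzero : laurent F := Laurent lzero_subproof.

Fact lopp_subproof f : exists N : int, forall n, N < n -> (fun n => - f n) n = 0.
Proof. by exists (lbound f) => n /lboundP ->; rewrite oppr0. Qed.
Definition lopp f : laurent F := Laurent (lopp_subproof f).

Fact ladd_subproof f g :
  exists N : int, forall n, N < n -> (fun n => f n + g n) n = 0.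
Proof.
exists (Num.max (lbound f) (lbound g)) => n; rewrite gt_max => /andP[fn gn].
by rewrite !lboundP ?addr0.
Qed.
Definition ladd f g : laurent F := Laurent (ladd_subproof f g).

Fact laddA : associative ladd.
Proof. by move=> f g h; apply: laurent_eq => n /=; rewrite addrA. Qed.
Fact laddC : commutative ladd.
Proof. by move=> f g; apply: laurent_eq => n /=; rewrite addrC. Qed.
Fact ladd0 : left_id lzero ladd.
Proof. by move=> f; apply: laurent_eq => n /=; rewrite add0r. Qed.
Fact laddN : left_inverse lzero lopp ladd.
Proof. by move=> f; apply: laurent_eq => n /=; rewrite addNr. Qed.

HB.instance Definition _ := GRing.isZmodule.Build (laurent F)
  laddA laddC ladd0 laddN.

Lemma lcoef0 n : (0 : laurent F) n = 0. Proof. by []. Qed.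
Lemma lcoefD f g n : (f + g) n = f n + g n. Proof. by []. Qed.
Lemma lcoefN f n : (- f) n = - f n. Proof. by []. Qed.
Lemma lcoefB f g n : (f - g) n = f n - g n. Proof. by []. Qed.

(* Only finitely many terms of this sum are nonzero. *)
Definition lconv u v n : F := \sum_(i \in [set: int]) u i * v (n - i).

Definition ltrunc N u (k : nat) : {poly F} := \poly_(i < k) u (N - i%:Z).

Lemma lconvE M N u v (k K : nat) :
    (forall n, M < n -> u n = 0) -> (forall n, N < n -> v n = 0) -> (k < K)%N ->
  lconv u v (M + N - k%:Z) = (ltrunc M u K * ltrunc N v K)`_k.
Proof.
move=> u0 v0 kK; rewrite /lconv.
pose r := [seq M - i%:Z | i <- iota 0 k.+1].
rewrite (fsbigE r) //; last 2 first.
- by rewrite map_inj_uniq ?iota_uniq // => i j /addrI/oppr_inj[].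
- move=> i _ ir; have [Mi|iM] := ltP M i; first by rewrite u0 ?mul0r.
  rewrite v0 ?mulr0 // ltNge; apply: contra ir => iN; apply/mapP.
  exists `|M - i|%N; last by lia.
  by rewrite mem_iota; lia.
rewrite (eq_bigl xpredT) => [|i]; last by rewrite in_setT.
rewrite big_map -/(index_iota 0 k.+1) big_mkord coefM; apply: eq_bigr => i _.
have ik : (i <= k)%N by rewrite -ltnS ltn_ord.
rewrite !coef_poly (leq_ltn_trans ik kK) (leq_ltn_trans (leq_subr _ _) kK).
by congr (_ * v _); lia.
Qed.

Lemma lconv_gt M N u v n :
    (forall n, M < n -> u n = 0) -> (forall n, N < n -> v n = 0) ->
  M + N < n -> lconv u v n = 0.
Proof.
move=> u0 v0 MNn; rewrite /lconv fsbig1 // => i _.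
have [Mi|iM] := ltP M i; first by rewrite u0 ?mul0r.
by rewrite v0 ?mulr0 //; lia.
Qed.

Fact lmul_subproof f g : exists N : int, forall n, N < n -> lconv f g n = 0.
Proof.
exists (lbound f + lbound g) => n.
by apply: lconv_gt => m; exact: lboundP.
Qed.
Definition lmul f g : laurent F := Laurent (lmul_subproof f g).

(* Two series bounded by N agree as soon as they agree at all N - k. *)
Lemma laurent_eq_le N f g :
    (forall n, N < n -> f n = 0) -> (forall n, N < n -> g n = 0) ->
  (forall k : nat, f (N - k%:Z) = g (N - k%:Z)) -> f = g.
Proof.
move=> f0 g0 fg; apply: laurent_eq => n.
have [Nn|nN] := ltP N n; first by rewrite f0 ?g0.
by have := fg `|N - n|%N; have -> : N - `|N - n|%N%:Z = n by lia.
Qed.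

Lemma lmul_gt f g n : lbound f + lbound g < n -> lmul f g n = 0.
Proof. by apply: lconv_gt => m; exact: lboundP. Qed.

Fact lmulC : commutative lmul.
Proof.
move=> f g; apply: (@laurent_eq_le (lbound f + lbound g)) => [n|n|k].
- exact: lmul_gt.
- by rewrite addrC; exact: lmul_gt.
rewrite /= (@lconvE _ _ _ _ k k.+1) //; try exact: lboundP.
rewrite [lbound f + _]addrC (@lconvE _ _ _ _ k k.+1) //; try exact: lboundP.
by rewrite mulrC.
Qed.

Lemma coefM_eq (p q r : {poly F}) (k : nat) :
  (forall i, (i <= k)%N -> p`_i = q`_i) -> (p * r)`_k = (q * r)`_k.
Proof.
by move=> pq; rewrite !coefM; apply: eq_bigr => i _; rewrite pq // -ltnS.
Qed.

Lemma ltrunc_lmul f g (i K : nat) : (i < K)%N ->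
  (ltrunc (lbound f + lbound g) (lmul f g) K)`_i =
  (ltrunc (lbound f) f K * ltrunc (lbound g) g K)`_i.
Proof.
move=> iK; rewrite coef_poly iK /= (@lconvE _ _ _ _ i K) //; exact: lboundP.
Qed.

Fact lmulA : associative lmul.
Proof.
move=> f g h; pose N := lbound f + lbound g + lbound h.
apply: (@laurent_eq_le N) => [n|n|k].
- rewrite /N -addrA; apply: lconv_gt; first exact: lboundP.
  exact: lmul_gt.
- apply: lconv_gt; last exact: lboundP.
  exact: lmul_gt.
rewrite /= [RHS](@lconvE _ _ _ _ k k.+1) //; last 2 first.
- exact: lmul_gt.
- exact: lboundP.
rewrite /N -(addrA (lbound f)) [LHS](@lconvE _ _ _ _ k k.+1) //; last 2 first.
- exact: lboundP.
- exact: lmul_gt.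
rewrite -/(lcoef (lmul f g)) -/(lcoef (lmul g h)) mulrC.
have gh (i : nat) : (i <= k)%N -> _ := @ltrunc_lmul g h i k.+1.
have fg (i : nat) : (i <= k)%N -> _ := @ltrunc_lmul f g i k.+1.
by rewrite (coefM_eq _ gh) (coefM_eq _ fg) mulrC mulrA.
Qed.

Fact lone_subproof :
  exists N : int, forall n, N < n -> (fun n : int => (n == 0)%:R : F) n = 0.
Proof. by exists 0 => n n0; rewrite gt_eqF. Qed.
Definition lone : laurent F := Laurent lone_subproof.

Fact lmul1 : left_id lone lmul.
Proof.
move=> f; apply: laurent_eq => n /=; rewrite /lconv.
rewrite (fsbigE [:: 0]) //=; last first.
  by move=> i _; rewrite inE => /negPf ->; rewrite mul0r.
by rewrite big_mkcond big_seq1 in_setT eqxx mul1r subr0.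
Qed.

Fact lmulDl : left_distributive lmul +%R.
Proof.
move=> f g h; apply: laurent_eq => n /=.
pose N := Num.max (lbound f) (lbound g).
have fN m : N < m -> f m = 0 by rewrite gt_max => /andP[/lboundP].
have gN m : N < m -> g m = 0 by rewrite gt_max => /andP[_ /lboundP].
have fgN m : N < m -> (f + g) m = 0.
  by move=> Nm; rewrite lcoefD fN // gN // addr0.
have hN := @lboundP h.
have [Nn|nN] := ltP (N + lbound h) n.
  by rewrite !(lconv_gt _ hN Nn) // addr0.
have -> : n = N + lbound h - (absz (N + lbound h - n)%R)%:Z by lia.
set k := absz _; rewrite !(@lconvE _ _ _ _ k k.+1) // -coefD -mulrDl.
suff -> : ltrunc N (f + g) k.+1 = ltrunc N f k.+1 + ltrunc N g k.+1 by [].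
by apply/polyP => i; rewrite coefD !coef_poly; case: ifP; rewrite ?addr0.
Qed.

Fact lone_neq0 : lone != 0.
Proof.
by apply/eqP => /(congr1 (fun f : laurent F => f 0)) /eqP; rewrite /= oner_eq0.
Qed.

HB.instance Definition _ := GRing.Zmodule_isComNzRing.Build (laurent F)
  lmulA lmulC lmul1 lmulDl lone_neq0.

Lemma lcoef1 n : (1 : laurent F) n = (n == 0)%:R. Proof. by []. Qed.
Lemma lcoefM f g n : (f * g) n = \sum_(i \in [set: int]) f i * g (n - i).
Proof. by []. Qed.

(* The degree of a nonzero series. *)
Lemma laurent_top f : f != 0 ->
  exists2 N, f N != 0 & forall n, N < n -> f n = 0.
Proof.
move=> f0; have [m fm] : exists m, f m != 0.
  apply: contra_notP (elimN eqP f0) => fn0; apply: laurent_eq => n.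
  by apply/eqP; apply: contra_notT fn0 => fn; exists n.
have exk : exists k : nat, f (lbound f - k%:Z) != 0.
  exists `|lbound f - m|%N; have : ~~ (lbound f < m).
    by apply: contra fm => /lboundP ->.
  by rewrite -leNgt => mf; have -> : lbound f - `|lbound f - m|%N%:Z = m by lia.
case: (ex_minnP exk) => k fk kmin; exists (lbound f - k%:Z) => // n kn.
have [/lboundP //|nf] := ltP (lbound f) n.
apply/eqP; apply: contraTT kn => fn.
have := kmin `|lbound f - n|%N.
by have -> : lbound f - `|lbound f - n|%N%:Z = n; [lia | move=> /(_ fn); lia].
Qed.

(* Coefficients of the inverse of a formal power series with coefficients c. *)
Fixpoint psinv_seq (c : nat -> F) (n : nat) : seq F :=
  if n isn't n'.+1 then [:: (c 0)^-1] else
  let s := psinv_seq c n' in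
  rcons s (- (c 0)^-1 * \sum_(i < n) s`_i * c (n - i)%N).

Definition psinv (c : nat -> F) (n : nat) := (psinv_seq c n)`_n.

Lemma size_psinv_seq (c : nat -> F) (n : nat) : size (psinv_seq c n) = n.+1.
Proof. by elim: n => //= n IHn; rewrite size_rcons IHn. Qed.

Lemma psinv_seqE (c : nat -> F) (n i : nat) : (i <= n)%N -> (psinv_seq c n)`_i = psinv c i.
Proof.
elim: n => [|n IHn]; first by rewrite leqn0 => /eqP ->.
rewrite leq_eqVlt => /predU1P[-> //|]; rewrite ltnS => ltin.
by rewrite /= nth_rcons size_psinv_seq ltnS ltin IHn.
Qed.

Lemma psinvS (c : nat -> F) (n : nat) : c 0%N != 0 ->
  \sum_(i < n.+2) psinv c i * c (n.+1 - i)%N = 0.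
Proof.
move=> c0; rewrite big_ord_recr /= subnn {2}/psinv /= nth_rcons.
rewrite size_psinv_seq ltnn eqxx mulrAC mulNr mulVf // mulN1r.
apply/eqP; rewrite subr_eq0; apply/eqP/eq_bigr => i _.
by rewrite psinv_seqE // -ltnS ltn_ord.
Qed.

Lemma laurent_unit f : f != 0 -> exists g, g * f = 1.
Proof.
move=> /laurent_top[N fN0 fN]; pose c (i : nat) := f (N - i%:Z).
have c0 : c 0%N != 0 by rewrite /c subr0.
pose v n := if n <= - N then psinv c (absz (- N - n)%R) else 0.
have v0 n : - N < n -> v n = 0 by rewrite /v ltNge => /negPf ->.
have Pv : exists M : int, forall n, M < n -> v n = 0 by exists (- N).
exists (Laurent Pv); apply: (@laurent_eq_le 0) => [n n0|n n0|k].
- by apply: (lconv_gt v0 fN); rewrite addNr.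
- by rewrite lcoef1 gt_eqF.
have -> : 0 - k%:Z = - N + N - k%:Z :> int by rewrite addNr.
rewrite /= (@lconvE _ _ _ _ k k.+1) // coefM addNr.
transitivity (\sum_(i < k.+1) psinv c i * c (k - i)%N).
  apply: eq_bigr => i _; rewrite !coef_poly ltn_ord ltnS leq_subr /v.
  by rewrite ifT; [congr (psinv c _ * _); lia | lia].
case: k => [|k]; last by rewrite psinvS //; apply/esym/eqP; rewrite pnatr_eq0; lia.
by rewrite big_ord1 /psinv /= mulVf // subr0.
Qed.

Definition linv f : laurent F :=
  if pselect (exists g, g * f = 1) is left e then sval (cid e) else 0.

Fact lmulVf f : f != 0 -> linv f * f = 1.
Proof.
move=> f0; rewrite /linv; case: pselect => [e|/(_ (laurent_unit f0))//].
exact: svalP (cid e).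
Qed.

Fact linv0 : linv 0 = 0.
Proof.
rewrite /linv; case: pselect => // e; exfalso.
by case: e => g /eqP; rewrite mulr0 eq_sym oner_eq0.
Qed.

HB.instance Definition _ := GRing.ComNzRing_isField.Build (laurent F)
  lmulVf linv0.

Fact lpoly_subproof (p : {poly F}) : exists N : int, forall n, N < n ->
  (fun n : int => if n is Posz i then p`_i else 0) n = 0.
Proof.
by exists (size p)%:Z => -[i|//] pi; apply: nth_default; apply: ltnW.
Qed.

(* The embedding of F[t]; the formal variable 'X plays the role of t. *)
Definition lpoly (p : {poly F}) : laurent F := Laurent (lpoly_subproof p).

Lemma lcoefXM f n : (lpoly 'X * f) n = f (n - 1).
Proof.
have tE i : lpoly 'X i = (i == 1)%:R by case: i => [i|//]; exact: coefX.
rewrite lcoefM (fsbigE [:: 1]) //; last first.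
  by move=> i _; rewrite inE tE => /negPf ->; rewrite mul0r.
by rewrite big_mkcond big_seq1 in_setT tE mul1r.
Qed.

Lemma lcoefXnM (j : nat) f n : (lpoly 'X ^+ j * f) n = f (n - j%:Z).
Proof.
elim: j n => [|j IHj] n; first by rewrite expr0 mul1r subr0.
by rewrite exprS -mulrA lcoefXM IHj; congr (f _); lia.
Qed.

(* The polynomial part, i.e. the terms of nonnegative degree. *)
Definition polypart f : {poly F} := \poly_(i < `|lbound f|.+1) f i%:Z.

Lemma coef_polypart f (i : nat) : (polypart f)`_i = f i%:Z.
Proof.
rewrite coef_poly; case: ltnP => // fi; apply/esym/lboundP.
by move: fi; lia.
Qed.

Lemma lcoef_fracpart f (i : nat) : (f - lpoly (polypart f)) i%:Z = 0.
Proof. by rewrite lcoefB /= coef_polypart subrr. Qed.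

(* Complete quotients: theta_0 = theta and theta_k = a_k + 1 / theta_(k+1), where
   a_k is the polynomial part of theta_k. As 0^-1 = 0, once the expansion of a
   rational theta terminates all further a_k are 0. *)
Fixpoint complete_quotient (theta : laurent F) (k : nat) : laurent F :=
  if k isn't k'.+1 then theta else
  let x := complete_quotient theta k' in (x - lpoly (polypart x))^-1.

Definition partial_quotient (theta : laurent F) (k : nat) : {poly F} :=
  polypart (complete_quotient theta k).

Lemma complete_quotientE theta k :
  complete_quotient theta k =
  lpoly (partial_quotient theta k) + (complete_quotient theta k.+1)^-1.
Proof. by rewrite /= invrK addrC subrK. Qed.

Lemma partial_quotient_deg theta k : complete_quotient theta k.+1 != 0 ->
  (1 < size (partial_quotient theta k.+1))%N.
Proof.
rewrite /partial_quotient /=.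
set g := _ - _ => g0; have gneq0 : g != 0 by rewrite -invr_eq0.
rewrite ltnNge; apply/negP => sg.
have g_lt n : -1 < n -> g n = 0.
  by case: n => // n _; exact: lcoef_fracpart.
have gV_le n : 0 < n -> g^-1 n = 0.
  case: n => // n n0; rewrite -coef_polypart nth_default //.
  exact: leq_trans sg n0.
have : (g * g^-1) 0 = 0 by apply: (lconv_gt g_lt gV_le).
by rewrite mulfV // lcoef1 eqxx => /eqP; rewrite oner_eq0.
Qed.

Definition cf_deg (theta : laurent F) (k : nat) : nat :=
  (size (partial_quotient theta k)).-1.

End LaurentField.

Definition cf_mass (R : realType) (F : fieldType) (theta : laurent F)
    (d : R) (k : nat) : R :=
  (\sum_(1 <= i < k.+1) Num.max ((cf_deg theta i)%:R - d) 0) /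
  (\sum_(1 <= i < k.+1) (cf_deg theta i)%:R).

Inductive letter := letter_a | letter_b.

Definition mu (x : letter) : seq letter :=
  match x with
  | letter_a => [:: letter_a; letter_b]
  | letter_b => [:: letter_b; letter_a]
  end.

Definition mu_word (w : seq letter) : seq letter := flatten (map mu w).

Definition tau (x : letter) : 'F_2 :=
  match x with letter_a => 0 | letter_b => 1 end.

(* The limit word, letters being numbered from 0. Since mu^i(a) has length
   2^i > i, its letter number i is the one of the limit: see [nth_iter_mu]. *)
Definition mu_limit (i : nat) : letter :=
  nth letter_a (iter i mu_word [:: letter_a]) i.

Lemma mu_word_cat w1 w2 : mu_word (w1 ++ w2) = mu_word w1 ++ mu_word w2.
Proof. by rewrite /mu_word map_cat flatten_cat. Qed.

Lemma size_iter_mu l w : size (iter l mu_word w) = (2 ^ l * size w)%N.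
Proof.
elim: l => [|l IHl] /=; first by rewrite mul1n.
rewrite expnS -mulnA -IHl; elim: (iter _ _ _) => //= x s IHs.
by rewrite size_cat IHs; case: x => /=; lia.
Qed.

Lemma iter_mu_prefix l m :
  exists w, iter (m + l) mu_word [:: letter_a] =
            iter l mu_word [:: letter_a] ++ w.
Proof.
have catl n w1 w2 :
    iter n mu_word (w1 ++ w2) = iter n mu_word w1 ++ iter n mu_word w2.
  by elim: n => //= n ->; rewrite mu_word_cat.
elim: m => [|m [w IHm]]; first by exists [::]; rewrite cats0.
have -> : iter (m.+1 + l) mu_word [:: letter_a] =
          iter (m + l) mu_word ([:: letter_a] ++ [:: letter_b]).
  by rewrite addSn iterSr.
by rewrite catl IHm -catA; eexists.
Qed.

(* The first 2^l letters of mu^l(a) are those of the limit word. *)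
Lemma nth_iter_mu l i : (i < 2 ^ l)%N ->
  nth letter_a (iter l mu_word [:: letter_a]) i = mu_limit i.
Proof.
move=> il; rewrite /mu_limit; have ii : (i < 2 ^ i)%N by exact: ltn_expl.
have [w1 e1] := iter_mu_prefix l i; have [w2 e2] := iter_mu_prefix i l.
transitivity (nth letter_a (iter (i + l) mu_word [:: letter_a]) i).
  by rewrite e1 nth_cat size_iter_mu muln1 il.
by rewrite addnC e2 nth_cat size_iter_mu muln1 ii.
Qed.

Definition thue_morse (n : nat) : 'F_2 := tau (mu_limit n.-1).

Fact thue_morse_series_subproof : exists N : int, forall n, N < n ->
  (fun n : int => if n is Negz i then thue_morse i.+1 else 0) n = 0.
Proof. by exists (-1) => -[]. Qed.

(* The sum over n >= 1 of thue_morse n * t^-n, as Negz i is - i.+1. *)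
Definition thue_morse_series : laurent 'F_2 :=
  Laurent thue_morse_series_subproof.

Lemma thue_morse_head :
  [seq thue_morse n | n <- iota 1 8] = [:: 0; 1; 1; 0; 1; 0; 0; 1].
Proof. by []. Qed.

(* Main.v *)
Require Import Defs.
From mathcomp Require Import all_boot all_order all_algebra.
From mathcomp Require Import all_classical all_reals all_analysis.
From mathcomp Require Import zify ring lra.

(** Write alpha for the Thue-Morse series and s = t + 1. The recursion of the
    Thue-Morse word is the quadratic equation s^3 alpha^2 + s^2 alpha = 1, so
    that z = 1 + s^2 alpha is a unit: z^2 = s z + 1, that is z + z^-1 = s, and
    z has degree -1. The field F_2(t, alpha) is therefore the rational function
    field F_2(z), the integral closure of F_2[t] is the ring F_2[z, z^-1], the
    conjugation exchanges z and w = z^-1 = z + s, and t = z + 1 + z^-1, whence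
    t^(2^m) = z^(2^m) + 1 + z^-(2^m). Everything below is computed with powers
    of z, whose degrees are known exactly.

    The mass is read off good approximations. Call (x, y) approximable for theta
    if some Q != 0 of degree at most x brings Q theta within degree -(y + 1) of
    a polynomial. For x <= y this says that no convergent denominator has its
    degree in ]x, y], so the sum of the (d_i - d)^+ up to the k-th partial
    quotient is the number of x < n_k such that (x, x + d) is approximable, n_k
    being the degree of the k-th denominator (sum_gaps). Multiplication by z^p,
    with p = 3 * 2^i and j <= 2^(i+1), preserves the F_2[t]-lattice spanned by 1
    and t^j alpha; it divides one absolute value by 2^p and multiplies the
    conjugate one by 2^p, so approximability is periodic of period p
    (approximable_periodic). Hence the mass converges, for integer d, to the
    density gap_count / p over one period; a real d is reached by linear
    interpolation between consecutive integers.

    Lower bound. If 2^i < j <= 2^(i+1), the powers z^(3 * 2^i) and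
    z^(3 * 2^(i-1)) = A + B z have B divisible by t^(2^(i+1)) and by t^(2^i).
    They give, in each period of length 3 * 2^i, two disjoint windows without
    denominator degrees, of lengths j and 2^(i+1) - j up to a constant
    (approximable_window). Together they cover 2^(i+1) of the 3 * 2^i degrees,
    which is the proportion 2/3, whatever j is.

    Upper bound. If j = 2^m, then for 0 < n < 2^(m-1) the element
    z^n + z^(2^m) (z^n + w^n) = z^n + z^(2^m + n) + z^(2^m - n) of the lattice
    has degree -n and comes from a denominator of degree n + 1 (central_form).
    These elements fill the third of the period left by the window, and leave
    no gap longer than 3 there (not_approximable). So the mass tends to exactly
    2/3 along the powers of 2, and the limit inferior is 2/3 for all d >= 3. *)

Set Implicit Arguments.
Unset Strict Implicit.
Unset Printing Implicit Defensive.

Import Order.TTheory GRing.Theory Num.Theory.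
Import numFieldNormedType.Exports.

Local Open Scope classical_set_scope.
Local Open Scope ring_scope.

(** * Degrees of Laurent series *)

Section Degree.
Context {F : fieldType}.
Implicit Types (f g : laurent F) (p q : {poly F}) (n m : int).

Definition ldeg_le f n := forall m, n < m -> f m = 0.

Definition ldeg f : int :=
  if pselect (f != 0) is left f0 then s2val (cid2 (laurent_top f0)) else 0.

Lemma ldegP f : f != 0 -> f (ldeg f) != 0 /\ ldeg_le f (ldeg f).
Proof. by rewrite /ldeg; case: pselect => // f0 _; case: cid2. Qed.

Lemma ldeg0 : ldeg 0 = 0.
Proof. by rewrite /ldeg; case: pselect => // f0; exfalso; rewrite eqxx in f0. Qed.

Lemma lcoef_neq0 f n : f n != 0 -> f != 0.
Proof. by apply: contraNneq => ->. Qed.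

Lemma ldeg_eq f n : f n != 0 -> ldeg_le f n -> ldeg f = n.
Proof.
move=> fn0 fn; have [fd0 fd] := ldegP (lcoef_neq0 fn0).
case: (ltgtP (ldeg f) n) => // [/fd /eqP|/fn /eqP]; first by rewrite (negPf fn0).
by rewrite (negPf fd0).
Qed.

Lemma ldeg_leW f n m : n <= m -> ldeg_le f n -> ldeg_le f m.
Proof. by move=> nm fn k mk; apply: fn; apply: le_lt_trans mk. Qed.

Lemma ldeg_leD f g n : ldeg_le f n -> ldeg_le g n -> ldeg_le (f + g) n.
Proof. by move=> fn gn m nm; rewrite lcoefD fn ?gn ?addr0. Qed.

Lemma ldeg_leN f n : ldeg_le f n -> ldeg_le (- f) n.
Proof. by move=> fn m nm; rewrite lcoefN fn ?oppr0. Qed.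

Lemma ldeg_leB f g n : ldeg_le f n -> ldeg_le g n -> ldeg_le (f - g) n.
Proof. by move=> fn gn; apply: ldeg_leD => //; apply: ldeg_leN. Qed.

Lemma ldeg_leM f g n m : ldeg_le f n -> ldeg_le g m -> ldeg_le (f * g) (n + m).
Proof. by move=> fn gm k; exact: lconv_gt. Qed.

Lemma ldeg_leE f n : f != 0 -> ldeg_le f n <-> ldeg f <= n.
Proof.
move=> f0; have [fd0 fd] := ldegP f0; split=> [fn|]; last by move/ldeg_leW; apply.
by rewrite leNgt; apply: contra fd0 => /fn ->.
Qed.

Lemma lcoefM_top f g n m :
  ldeg_le f n -> ldeg_le g m -> (f * g) (n + m) = f n * g m.
Proof.
move=> fn gm; rewrite -[n + m]subr0.
rewrite [LHS](@lconvE _ n m f g 0 1) // coefM big_ord1 !coef_poly /=.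
by rewrite !subr0.
Qed.

Lemma ldegM f g : f != 0 -> g != 0 -> ldeg (f * g) = ldeg f + ldeg g.
Proof.
move=> /ldegP[f0 fn] /ldegP[g0 gn]; apply: ldeg_eq; last exact: ldeg_leM.
by rewrite lcoefM_top // mulf_neq0.
Qed.

Lemma ldeg1 : ldeg (1 : laurent F) = 0.
Proof.
apply: ldeg_eq => [|n n0]; first by rewrite lcoef1 eqxx oner_neq0.
by rewrite lcoef1 gt_eqF.
Qed.

Lemma ldegV f : f != 0 -> ldeg f^-1 = - ldeg f.
Proof.
move=> f0; apply/eqP; rewrite -addr_eq0 addrC -ldegM ?invr_eq0 //.
by rewrite mulfV // ldeg1.
Qed.

Lemma ldegX f k : f != 0 -> ldeg (f ^+ k) = ldeg f *+ k.
Proof.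
move=> f0; elim: k => [|k IHk]; first by rewrite expr0 ldeg1.
by rewrite exprS ldegM ?expf_neq0 // IHk mulrS.
Qed.

Lemma ldegDl f g n : f != 0 -> ldeg_le g n -> n < ldeg f ->
  f + g != 0 /\ ldeg (f + g) = ldeg f.
Proof.
move=> /ldegP[fd0 fd] gn nf.
have fg0 : (f + g) (ldeg f) != 0 by rewrite lcoefD [g _]gn // addr0.
split; first exact: lcoef_neq0 fg0.
by apply: ldeg_eq => //; apply: ldeg_leD => //; apply: ldeg_leW gn; apply: ltW.
Qed.

Lemma lpolyD : {morph @lpoly F : p q / p + q}.
Proof.
by move=> p q; apply: laurent_eq => -[i|i]; rewrite lcoefD /= ?addr0 ?coefD.
Qed.

Lemma lpolyN : {morph @lpoly F : p / - p}.
Proof.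
by move=> p; apply: laurent_eq => -[i|i]; rewrite lcoefN /= ?oppr0 ?coefN.
Qed.

Lemma lpolyB : {morph @lpoly F : p q / p - q}.
Proof. by move=> p q; rewrite lpolyD lpolyN. Qed.

Lemma lpoly0 : lpoly (0 : {poly F}) = 0.
Proof. by rewrite -(subrr 0) lpolyB subrr. Qed.

Lemma lpoly1 : lpoly (1 : {poly F}) = 1.
Proof.
by apply: laurent_eq => -[i|i]; rewrite lcoef1 /= ?coef1.
Qed.

Lemma lpolyM : {morph @lpoly F : p q / p * q}.
Proof.
have lpolyXM r : lpoly ('X * r) = lpoly 'X * lpoly r :> laurent F.
  apply: laurent_eq => -[[|i]|i]; rewrite lcoefXM /= ?coefXM //=.
  by congr (r`_ _); lia.
have lpolyCM c r : lpoly (c%:P * r) = lpoly c%:P * lpoly r :> laurent F.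
  apply: laurent_eq => n; rewrite lcoefM (fsbigE [:: 0]) //; last first.
    by case=> [[|i]|i] _; rewrite inE // => _; rewrite /= ?coefC mul0r.
  rewrite big_mkcond big_seq1 in_setT subr0 /= coefC /=.
  by case: n => n /=; rewrite ?mulr0 // coefCM.
move=> p q; elim/poly_ind: p => [|p c IHp]; first by rewrite lpoly0 !mul0r lpoly0.
rewrite mulrDl [p * 'X]mulrC -mulrA !lpolyD !lpolyXM lpolyCM IHp.
by rewrite mulrDl mulrA.
Qed.

Lemma lpolyX k : {morph @lpoly F : p / p ^+ k}.
Proof.
by move=> p; elim: k => [|k IHk]; rewrite ?expr0 ?lpoly1 // !exprS lpolyM IHk.
Qed.

Lemma ldeg_le_lpoly p (k : nat) : ldeg_le (lpoly p) k%:Z <-> (size p <= k.+1)%N.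
Proof.
split=> [pk|pk [i|i] ki] //=; last first.
  by apply: nth_default; apply: leq_trans pk _; rewrite -ltz_nat.
by apply/leq_sizeP => i ki; have := pk i%:Z; rewrite /=; apply; lia.
Qed.

Lemma lpoly_eq0 p : (lpoly p == 0) = (p == 0).
Proof.
apply/eqP/eqP => [p0|->]; last exact: lpoly0.
by apply/polyP => i; rewrite coef0; have := congr1 (fun f : laurent F => f i%:Z) p0.
Qed.

Lemma lpoly_lt0 p : ldeg_le (lpoly p) (- 1) -> p = 0.
Proof. by move=> p0; apply/polyP => i; rewrite coef0; apply: (p0 i%:Z). Qed.

Lemma ldeg_lpoly p : p != 0 -> ldeg (lpoly p) = (size p).-1%:Z.
Proof.
move=> p0; apply: ldeg_eq; first by rewrite /= -lead_coefE lead_coef_eq0.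
by apply/ldeg_le_lpoly; lia.
Qed.

Lemma ldeg_lpoly_ge0 p : 0 <= ldeg (lpoly p).
Proof.
have [->|p0] := eqVneq p 0; last by rewrite ldeg_lpoly.
by rewrite lpoly0 ldeg0.
Qed.

Lemma ldeg_le_fracpart f : ldeg_le (f - lpoly (polypart f)) (- 1).
Proof. by case=> // i _; exact: lcoef_fracpart. Qed.

Lemma ldeg_polypart f : 0 <= ldeg f -> (size (polypart f)).-1%:Z = ldeg f.
Proof.
have [->|f0] := eqVneq f 0.
  have -> : polypart (0 : laurent F) = 0.
    by apply/polyP => i; rewrite coef_polypart coef0.
  by rewrite size_poly0 ldeg0.
move=> fd; have [fd0 fdl] := ldegP f0.
have [|_ pf] := ldegDl f0 (ldeg_leN (ldeg_le_fracpart f)).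
  exact: lt_le_trans fd.
rewrite opprB addrC subrK in pf; rewrite -pf ldeg_lpoly //.
apply/eqP => p0; move: (ldeg_le_fracpart f); rewrite p0 lpoly0 subr0.
by move/(ldeg_leE _ f0) => fd'; have := le_trans fd fd'.
Qed.

End Degree.

(** * Continued fractions and good approximations *)

Section Approximation.
Context {F : fieldType}.
Implicit Types (theta f : laurent F) (P Q : {poly F}) (x y d k : nat).

Definition irrational theta :=
  forall Q P, Q != 0 -> lpoly Q * theta != lpoly P.

(** For x <= y this is the absence of a convergent denominator of degree in
    ]x, y]; it avoids manipulating the convergents themselves. *)
Definition approximable theta x y := exists Q P,
  [/\ Q != 0, (size Q <= x.+1)%N & ldeg_le (lpoly Q * theta - lpoly P) (- y.+1%:Z)].

Lemma approximableW theta x y y' : (y' <= y)%N ->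
  approximable theta x y -> approximable theta x y'.
Proof.
move=> yy [Q [P [Q0 Qx QP]]]; exists Q, P; split=> //.
by apply: ldeg_leW QP; lia.
Qed.

Definition gap_count theta d n : nat :=
  \sum_(0 <= x < n) `[< approximable theta x (x + d) >].

Lemma complete_quotient_shift theta k :
  complete_quotient theta k.+1 = complete_quotient (complete_quotient theta 1) k.
Proof. by elim: k => //= k ->. Qed.

Lemma cf_deg_shift theta k :
  cf_deg theta k.+1 = cf_deg (complete_quotient theta 1) k.
Proof. by rewrite /cf_deg /partial_quotient complete_quotient_shift. Qed.

(** A linear form in theta becomes, after multiplication by theta1, a linear form
    in theta1 whose denominator is P - Q a_0 and whose numerator is Q. The theory
    of convergents reduces to this step, iterated through
    [complete_quotient_shift]. *)
Section GaussMap.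
Variable theta : laurent F.
Hypothesis theta_irr : irrational theta.
Let theta1 := complete_quotient theta 1.

Lemma irrational_frac_neq0 : theta - lpoly (polypart theta) != 0.
Proof.
rewrite subr_eq0 -[theta in theta == _]mul1r -lpoly1.
by apply: theta_irr; rewrite oner_neq0.
Qed.

Lemma cq1E : theta = lpoly (polypart theta) + theta1^-1.
Proof. exact: (complete_quotientE theta 0). Qed.

Lemma cq1_neq0 : theta1 != 0.
Proof. by rewrite invr_eq0 irrational_frac_neq0. Qed.

Lemma ldeg_cq1_gt0 : 0 < ldeg theta1.
Proof.
rewrite ldegV ?irrational_frac_neq0 // oppr_gt0.
have /(ldeg_leE _ irrational_frac_neq0) := @ldeg_le_fracpart _ theta.
by move/le_lt_trans; apply.
Qed.

Lemma ldeg_cq1 : ldeg theta1 = (cf_deg theta 1)%:Z.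
Proof.
by rewrite /cf_deg ldeg_polypart //; apply/ltW/ldeg_cq1_gt0.
Qed.

Lemma irrational_cq1 : irrational theta1.
Proof.
move=> Q P Q0; apply/eqP => QP.
have P0 : P != 0.
  by rewrite -lpoly_eq0 -QP mulf_neq0 ?lpoly_eq0 // cq1_neq0.
have /eqP[] := theta_irr (Q + P * polypart theta) P0.
rewrite {1}cq1E mulrDr lpolyD -lpolyM -QP addrC; congr (_ + _).
by rewrite -mulrA mulfV ?mulr1 // cq1_neq0.
Qed.

Lemma linear_form_step Q P :
  lpoly Q * theta - lpoly (P + Q * polypart theta) =
  (lpoly Q - lpoly P * theta1) / theta1.
Proof.
rewrite lpolyD lpolyM {1}cq1E mulrBl -mulrA mulfV ?cq1_neq0 //.
by ring.
Qed.

(** Below the degree of the first partial quotient the denominator 1 is already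
    the best one, because Q * theta1^-1 has no polynomial part. *)
Lemma approximable_lt x y : (x < cf_deg theta 1)%N -> (x <= y)%N ->
  approximable theta x y <-> (y < cf_deg theta 1)%N.
Proof.
have t0 := cq1_neq0; have tV0 := invr_neq0 t0; have td := ldeg_cq1.
move=> xd xy; split=> [[Q [P [Q0 Qx QP]]]|yd]; last first.
  exists 1, (polypart theta); rewrite oner_neq0 size_poly1; split=> //.
  rewrite lpoly1 mul1r {1}cq1E addrC addKr (ldeg_leE _ tV0).
  by rewrite ldegV // td lerN2 lez_nat.
move: QP; rewrite -[P](subrK (Q * polypart theta)) linear_form_step.
set P' := P - _ => QP.
have Ql0 : lpoly Q != 0 by rewrite lpoly_eq0.
have QV0 : lpoly Q / theta1 != 0 by rewrite mulf_neq0.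
have QVd : ldeg (lpoly Q / theta1) = (size Q).-1%:Z - (cf_deg theta 1)%:Z.
  by rewrite ldegM // ldeg_lpoly // ldegV // td.
have P'0 : P' = 0.
  apply: lpoly_lt0.
  have -> : lpoly P' = lpoly Q / theta1 - (lpoly Q - lpoly P' * theta1) / theta1.
    by field.
  apply: ldeg_leB; last by apply: ldeg_leW QP; lia.
  by rewrite ldeg_leE // QVd; lia.
move: QP; rewrite P'0 lpoly0 mul0r subr0 ldeg_leE // QVd; lia.
Qed.

(** Both directions exchange numerator and denominator by [linear_form_step]:
    P is within degree -1 of Q * theta1^-1, so its degree is deg Q - deg a_1. *)
Lemma approximable_ge x y : (cf_deg theta 1 <= x)%N -> (x <= y)%N ->
  approximable theta x y <->
  approximable theta1 (x - cf_deg theta 1) (y - cf_deg theta 1).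
Proof.
have t0 := cq1_neq0; have tV0 := invr_neq0 t0; have td := ldeg_cq1; have tp := ldeg_cq1_gt0.
move=> dx xy; split=> [[Q [P [Q0 Qx QP]]]|[Q [P [Q0 Qx QP]]]]; last first.
  have P0 : P != 0.
    apply/eqP => P0; move: QP; rewrite P0 lpoly0 subr0 ldeg_leE; last first.
      by rewrite mulf_neq0 // lpoly_eq0.
    by rewrite ldegM ?lpoly_eq0 // ldeg_lpoly //; lia.
  exists P, (Q + P * polypart theta); split=> //.
    apply/ldeg_le_lpoly.
    have -> : lpoly P = lpoly Q * theta1 - (lpoly Q * theta1 - lpoly P) by ring.
    apply: ldeg_leB; last by apply: ldeg_leW QP; lia.
    rewrite ldeg_leE ?ldegM ?mulf_neq0 ?lpoly_eq0 // ldeg_lpoly //; lia.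
  rewrite linear_form_step.
  have -> : - y.+1%:Z = - (y - cf_deg theta 1)%N.+1%:Z + - (cf_deg theta 1)%:Z.
    lia.
  apply: ldeg_leM; first by rewrite -opprB; apply: ldeg_leN.
  by rewrite (ldeg_leE _ tV0) ldegV // td.
move: QP; rewrite -[P](subrK (Q * polypart theta)) linear_form_step.
set P' := P - _ => QP.
have Ql0 : lpoly Q != 0 by rewrite lpoly_eq0.
have QV0 : lpoly Q / theta1 != 0 by rewrite mulf_neq0.
have QVd : ldeg (lpoly Q / theta1) = (size Q).-1%:Z - (cf_deg theta 1)%:Z.
  by rewrite ldegM // ldeg_lpoly // ldegV // td.
exists P', Q; split.
- apply/eqP => P'0; move: QP; rewrite P'0 lpoly0 mul0r subr0 ldeg_leE // QVd.
  by lia.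
- apply/ldeg_le_lpoly.
  have -> : lpoly P' = lpoly Q / theta1 - (lpoly Q - lpoly P' * theta1) / theta1.
    by field.
  apply: ldeg_leB; last by apply: ldeg_leW QP; lia.
  by rewrite ldeg_leE // QVd; lia.
rewrite -opprB; apply: ldeg_leN.
rewrite -[_ - _](mulfVK t0).
have -> : - (y - cf_deg theta 1)%N.+1%:Z = - y.+1%:Z + (cf_deg theta 1)%:Z by lia.
by apply: ldeg_leM => //; rewrite ldeg_leE // td.
Qed.

End GaussMap.

Lemma sum_cf_degS theta (f : nat -> nat) k :
  (\sum_(1 <= i < k.+2) f (cf_deg theta i) = f (cf_deg theta 1) +
   \sum_(1 <= i < k.+1) f (cf_deg (complete_quotient theta 1) i))%N.
Proof.
rewrite big_ltn // big_add1; congr (_ + _)%N.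
by apply: eq_bigr => i _; rewrite cf_deg_shift.
Qed.

Lemma gap_count_lt theta d n : irrational theta -> (n <= cf_deg theta 1)%N ->
  gap_count theta d n = minn n (cf_deg theta 1 - d).
Proof.
move=> th_irr; elim: n => [|n IHn] nd; first by rewrite /gap_count big_geq ?min0n.
rewrite /gap_count big_nat_recr //= -/(gap_count _ _ _) IHn; last exact: ltnW.
have -> : `[< approximable theta n (n + d) >] = (n + d < cf_deg theta 1)%N.
  apply/asboolP/idP; first by move/approximable_lt; apply=> //; apply: leq_addr.
  by move=> ?; apply/approximable_lt => //; apply: leq_addr.
lia.
Qed.

(** The x between two consecutive denominator degrees n < n' that are counted
    are those with x + d < n', and there are n' - n - d of them, truncated at
    zero. *)
Lemma sum_gaps theta d k : irrational theta ->
  (\sum_(1 <= i < k.+1) (cf_deg theta i - d) =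
   gap_count theta d (\sum_(1 <= i < k.+1) cf_deg theta i))%N.
Proof.
elim: k theta => [|k IHk] theta th_irr.
  by rewrite !big_geq // /gap_count big_geq.
rewrite (sum_cf_degS theta (subn^~ d)) (sum_cf_degS theta id) IHk; last first.
  exact: irrational_cq1.
set n := (\sum_(_ <= _ < _) _)%N; set d1 := cf_deg theta 1.
have d1E : gap_count theta d d1 = (d1 - d)%N.
  by rewrite gap_count_lt //; apply/minn_idPr/leq_subr.
rewrite [RHS]/gap_count [RHS](@big_cat_nat _ _ _ d1) ?leq_addr //=.
rewrite -/(gap_count theta d d1) d1E; congr (_ + _)%N.
rewrite -{1}[d1]add0n big_addn addKn; apply: eq_bigr => x _; congr nat_of_bool.
apply/asbool_equiv_eq; apply: iff_sym.
have := @approximable_ge theta th_irr (x + d1) (x + d1 + d).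
by rewrite addnAC !addnK; apply; lia.
Qed.

(** Every partial quotient of an irrational series has positive degree. *)
Lemma leq_sum_cf_deg theta k : irrational theta ->
  (k <= \sum_(1 <= i < k.+1) cf_deg theta i)%N.
Proof.
elim: k theta => [|k IHk] theta th_irr //; rewrite (sum_cf_degS theta id).
have := IHk _ (irrational_cq1 th_irr).
have := ldeg_cq1_gt0 th_irr; rewrite ldeg_cq1 //; lia.
Qed.

End Approximation.

(** * The Thue-Morse series and the unit zeta *)

Lemma addF2 (a : 'F_2) : a + a = 0.
Proof. by case: a => [[|[|//]]] ?; apply: val_inj. Qed.

Lemma mulF2 (a : 'F_2) : a * a = a.
Proof. by case: a => [[|[|//]]] ?; apply: val_inj. Qed.

Lemma addl2 (f : laurent 'F_2) : f + f = 0.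
Proof. by apply: laurent_eq => n; rewrite lcoefD addF2. Qed.

(** The way to use the characteristic with [ring], which reasons over the
    integers: h is half of the difference of the two sides. *)
Lemma eql2 (f g h : laurent 'F_2) : f = g + (h + h) -> f = g.
Proof. by rewrite addl2 addr0. Qed.

Lemma coef_sqrF2 (p : {poly 'F_2}) k :
  (p * p)`_k = if odd k then 0 else p`_(k./2).
Proof.
elim/poly_ind: p k => [|p c IHp] k; first by rewrite mul0r !coef0 if_same.
have pp2 (q : {poly 'F_2}) : q + q = 0.
  by apply/polyP => i; rewrite coefD addF2 coef0.
have -> : (p * 'X + c%:P) * (p * 'X + c%:P) =
          p * p * 'X * 'X + (c * c)%:P + (p * 'X * c%:P + p * 'X * c%:P).
  by rewrite polyCM; ring.
rewrite pp2 addr0 mulF2 !coefD !coefMX !coefC.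
case: k => [|[|k]] /=; rewrite ?addr0 ?add0r //.
by rewrite negbK IHp.
Qed.

Lemma nth_mu_word w i (b : bool) : (i < size w)%N ->
  nth letter_a (mu_word w) (i.*2 + b) = nth letter_a (mu (nth letter_a w i)) b.
Proof.
elim: w i => //= x w IHw [|i]; last first.
  rewrite ltnS => /IHw <-; rewrite /mu_word /= nth_cat.
  have -> : size (mu x) = 2%N by case: x.
  by rewrite doubleS !addSn ltnNge /= subn2.
by move=> _; rewrite /mu_word /= nth_cat; case: x {IHw}; case: b.
Qed.

Lemma tau_mu_limit i (b : bool) :
  tau (mu_limit (i.*2 + b)) = tau (mu_limit i) + b%:R.
Proof.
have il : (i < 2 ^ i)%N by exact: ltn_expl.
have il2 : (i.*2 + b < 2 ^ i.+1)%N by rewrite expnS; case: b => /=; lia.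
rewrite -(nth_iter_mu il2) iterS nth_mu_word ?size_iter_mu ?muln1 //.
by rewrite (nth_iter_mu il); case: (mu_limit i); case: b {il2}; apply: val_inj.
Qed.

Local Notation alpha := thue_morse_series.
Local Notation t := (lpoly 'X : laurent 'F_2).
Local Notation s := (lpoly ('X + 1) : laurent 'F_2).

Lemma ldeg_le_alpha : ldeg_le alpha (- 1).
Proof. by case. Qed.

Lemma coef_alpha_sqr (k : nat) :
  (alpha * alpha) (- 2 - k%:Z) = if odd k then 0 else tau (mu_limit k./2).
Proof.
have -> : - 2 - k%:Z = - 1 + - 1 - k%:Z :> int by [].
rewrite [LHS](@lconvE _ _ _ alpha alpha k k.+1) //; try exact: ldeg_le_alpha.
rewrite coef_sqrF2; case: ifP => // _; rewrite coef_poly ifT; last by lia.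
by have -> : - 1 - k./2%:Z = Negz k./2 by lia.
Qed.

(** Squaring doubles exponents, so alpha + s alpha^2 compares the letters 2i and
    2i + 1 of the word with the letter i: the first comparison gives 0, the second
    gives 1, and the sum is t^-2 + t^-4 + ... = s^-2. *)
Lemma coef_alpha_quad n : (alpha + s * (alpha * alpha)) n =
  if n is Negz i then (odd i)%:R else 0.
Proof.
rewrite lcoefD lpolyD lpoly1 mulrDl mul1r [X in _ + X]lcoefD lcoefXM.
have A0 m : - 2 < m -> (alpha * alpha) m = 0.
  by apply: (ldeg_leM ldeg_le_alpha ldeg_le_alpha).
case: n => [n|i]; first by rewrite !A0 ?addr0 //; lia.
have -> : Negz i - 1 = - 2 - i%:Z by lia.
have -> : alpha (Negz i) = tau (mu_limit i) by [].
rewrite coef_alpha_sqr.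
case: i => [|i]; first by rewrite A0 //; apply: val_inj.
have -> : Negz i.+1 = - 2 - i%:Z by lia.
rewrite coef_alpha_sqr -{1}(odd_double_half i.+1) addnC tau_mu_limit /=.
rewrite uphalf_half; case: (odd i) => /=.
  by rewrite !addr0 addF2.
by rewrite add0r addrAC addF2 add0r.
Qed.

(** This is [coef_alpha_quad], alpha + s alpha^2 = s^-2, without denominators. *)
Lemma alpha_quad : s ^+ 3 * alpha ^+ 2 + s ^+ 2 * alpha = 1.
Proof.
set B := alpha + s * (alpha * alpha).
have -> : s ^+ 3 * alpha ^+ 2 + s ^+ 2 * alpha = t ^+ 2 * B + B.
  rewrite lpolyD lpoly1 /B lpolyD lpoly1; apply: (@eql2 _ _ (t * B)).
  by rewrite /B lpolyD lpoly1; ring.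
apply: laurent_eq => n; rewrite lcoefD lcoefXnM !coef_alpha_quad lcoef1.
case: n => [[|[|n]]|[|[|i]]] //=; rewrite ?addr0 ?addF2 //.
by rewrite addn1 /= !negbK addF2.
Qed.

(** A fundamental unit of the integral closure of F_2[t] in F_2(t, alpha). *)
Definition zeta : laurent 'F_2 := 1 + s ^+ 2 * alpha.
Local Notation z := zeta.
Local Notation w := (z + s).
Local Notation talpha j := (lpoly 'X ^+ j * thue_morse_series).

Lemma zeta_quad : z ^+ 2 = s * z + 1.
Proof.
have := alpha_quad; rewrite /zeta; set a := alpha; set x := lpoly _ => H.
apply: (@eql2 _ _ (x ^+ 2 * a - x ^+ 3 * a)).
have -> : (1 + x ^+ 2 * a) ^+ 2 =
    1 + (x ^+ 2 * a + x ^+ 2 * a) + x * (x ^+ 3 * a ^+ 2 + x ^+ 2 * a) - x ^+ 3 * a.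
  by ring.
by rewrite H; ring.
Qed.

(** w = z + s is both the conjugate and the inverse of z, which makes the
    conjugate absolute value computable: it is the degree of w. *)
Lemma zeta_conj_quad : w ^+ 2 = s * w + 1.
Proof.
apply: (@eql2 _ _ (z * s)).
by rewrite sqrrD zeta_quad; ring.
Qed.

Lemma zetaV : z * w = 1.
Proof. by apply: (@eql2 _ _ (s * z)); rewrite mulrDr -expr2 zeta_quad; ring. Qed.

Lemma zeta_neq0 : z != 0.
Proof. by apply/eqP => z0; have /eqP := zetaV; rewrite z0 mul0r eq_sym oner_eq0. Qed.

Lemma zetac_neq0 : w != 0.
Proof. by apply/eqP => z0; have /eqP := zetaV; rewrite z0 mulr0 eq_sym oner_eq0. Qed.

Lemma s_neq0 : s != 0.
Proof. by rewrite lpoly_eq0 -size_poly_gt0 size_XaddC. Qed.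

Lemma t_neq0 : t != 0.
Proof. by rewrite lpoly_eq0 polyX_eq0. Qed.

Lemma ldeg_s : ldeg s = 1.
Proof. by rewrite ldeg_lpoly -?lpoly_eq0 ?s_neq0 // size_XaddC. Qed.

Lemma ldeg_t : ldeg t = 1.
Proof. by rewrite ldeg_lpoly -?lpoly_eq0 ?t_neq0 // size_polyX. Qed.

Lemma ldeg_zeta_conj : ldeg w = 1.
Proof.
suff zd : ldeg_le z (- 1).
  by rewrite addrC; have [] := ldegDl s_neq0 zd; rewrite ldeg_s.
have -> : z = 1 + alpha + t ^+ 2 * alpha.
  apply: (@eql2 _ _ (t * alpha)); rewrite /zeta lpolyD lpoly1; ring.
move=> n n0; rewrite !lcoefD lcoefXnM lcoef1.
by case: n n0 => // -[|[|n]] _ //=; rewrite ?addr0 ?addF2.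
Qed.

Lemma ldeg_zeta : ldeg z = - 1.
Proof.
apply/eqP; rewrite -addr_eq0 -ldeg_zeta_conj.
by rewrite -ldegM ?zeta_neq0 ?zetac_neq0 // zetaV ldeg1.
Qed.

Lemma ldeg_sX k : ldeg (s ^+ k) = k%:Z.
Proof. by rewrite ldegX ?s_neq0 // ldeg_s natz. Qed.

Lemma ldeg_tX k : ldeg (t ^+ k) = k%:Z.
Proof. by rewrite ldegX ?t_neq0 // ldeg_t natz. Qed.

Lemma ldeg_zetaX k : ldeg (z ^+ k) = - k%:Z.
Proof. by rewrite ldegX ?zeta_neq0 // ldeg_zeta mulNrn natz. Qed.

Lemma ldeg_zetacX k : ldeg (w ^+ k) = k%:Z.
Proof. by rewrite ldegX ?zetac_neq0 // ldeg_zeta_conj natz. Qed.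

(** If D z is a polynomial for some polynomial D, then so is D z^n for all n, and
    its degree deg D - n cannot stay nonnegative. *)
Lemma irrational_theta j : irrational (talpha j).
Proof.
move=> Q P Q0; apply/eqP => QP; pose D := Q * 'X^j.
have D0 : lpoly D != 0.
  by rewrite lpolyM mulf_neq0 ?lpolyX ?expf_neq0 ?t_neq0 ?lpoly_eq0.
have Dz n : exists R R', lpoly R = lpoly D * z ^+ n /\ lpoly R' = lpoly D * z ^+ n.+1.
  elim: n => [|n [R [R' [RE R'E]]]].
    exists D, (D + ('X + 1) ^+ 2 * P); split; first by rewrite expr0 mulr1.
    by rewrite /D lpolyD !lpolyM -QP !lpolyX /zeta; ring.
  exists R', (('X + 1) * R' + R); split=> //.
  have -> : z ^+ n.+2 = z ^+ n * z ^+ 2 by rewrite -exprD addn2.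
  by rewrite lpolyD lpolyM RE R'E zeta_quad exprS; ring.
have [R [_ [RE _]]] := Dz (size D).
have := @ldeg_lpoly_ge0 _ R; rewrite RE ldegM ?expf_neq0 ?zeta_neq0 //.
rewrite ldeg_zetaX ldeg_lpoly -?lpoly_eq0 //.
have : (0 < size D)%N by rewrite size_poly_gt0 -lpoly_eq0.
lia.
Qed.

Lemma root_double (n : nat) (A B : {poly 'F_2}) (r : laurent 'F_2) :
    r ^+ 2 = s * r + 1 -> r ^+ n = lpoly A + lpoly B * r ->
  r ^+ n.*2 = lpoly (A ^+ 2 + B ^+ 2) + lpoly (('X + 1) * B ^+ 2) * r.
Proof.
move=> r2 rn; rewrite -muln2 exprM rn.
apply: (@eql2 _ _ (lpoly A * lpoly B * r)).
rewrite lpolyD (lpolyM (_ + _)) !(lpolyX 2).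
have -> : (lpoly A + lpoly B * r) ^+ 2 =
  lpoly A ^+ 2 + lpoly B ^+ 2 * r ^+ 2 + (lpoly A * lpoly B * r + lpoly A * lpoly B * r).
  by ring.
by rewrite r2; ring.
Qed.

(** Repeated squaring in characteristic 2, with coefficients that serve both
    roots z and w of r^2 = s r + 1. *)
Lemma root_pow2 (n : nat) (A B : {poly 'F_2}) i :
    (forall r : laurent 'F_2, r ^+ 2 = s * r + 1 -> r ^+ n = lpoly A + lpoly B * r) ->
  exists C, forall r : laurent 'F_2, r ^+ 2 = s * r + 1 ->
    r ^+ (n * 2 ^ i) = lpoly C + s ^+ (2 ^ i).-1 * lpoly B ^+ (2 ^ i) * r.
Proof.
move=> rn; elim: i => [|i [C IHi]].
  by exists A => r r2; rewrite muln1 expr0 expr1 mul1r rn.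
pose D := ('X + 1) ^+ (2 ^ i).-1 * B ^+ (2 ^ i).
exists (C ^+ 2 + D ^+ 2) => r r2.
have -> : (n * 2 ^ i.+1 = (n * 2 ^ i).*2)%N by rewrite expnS; lia.
rewrite (@root_double _ C D) //; last by rewrite IHi // lpolyM !lpolyX.
congr (_ + _ * r); rewrite lpolyM !(lpolyX, lpolyM) exprMn -!exprM mulrA -exprS.
congr (s ^+ _ * _ ^+ _); last by rewrite expnS; lia.
by have := expn_gt0 2 i; rewrite expnS; lia.
Qed.

(** The exponent 3 is the order of z modulo t, as z^2 + z + 1 = 0 there; each
    squaring doubles the power of t dividing the coefficient of r. *)
Lemma root_pow3 i : exists C, forall r : laurent 'F_2, r ^+ 2 = s * r + 1 ->
  r ^+ (3 * 2 ^ i) = lpoly C + s ^+ (2 ^ i).-1 * t ^+ (2 ^ i.+1) * r.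
Proof.
have [|C HC] := @root_pow2 3 ('X + 1) ('X^2) i.
  move=> r r2; rewrite exprS r2 lpolyX; apply: (@eql2 _ _ (t * r)).
  have -> : r * (s * r + 1) = s * r ^+ 2 + r by ring.
  by rewrite r2 lpolyD lpoly1; apply: (@eql2 _ _ r); ring.
by exists C => r /HC ->; rewrite lpolyX -exprM expnS.
Qed.

(** * Periodicity and large partial quotients *)

(** Multiplication by e = A + B z maps the lattice spanned by 1 and t^j alpha to
    itself as soon as B is divisible by s t^j: then B z - B = (B s^2 / t^j) t^j alpha,
    and (B s^2 alpha) t^j alpha is reduced by the quadratic equation. If
    f = Q theta - P, the new denominator is Q e' + f s^3 B0 with e' the conjugate
    of e, so that its degree is governed by the one of e'. The exponent p may be
    negative. *)
Lemma approximable_shift j (A B0 : {poly 'F_2}) (p : int) (x y x' y' : nat) :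
    let B := ('X + 1) * 'X^j * B0 in
    lpoly A + lpoly B * z != 0 ->
    ldeg (lpoly A + lpoly B * z) = - p ->
    ldeg (lpoly A + lpoly B * w) = p ->
    ldeg_le (lpoly (('X + 1) ^+ 3 * B0)) (p + x%:Z + y.+1%:Z) ->
    x'%:Z = x%:Z + p -> y'%:Z = y%:Z + p ->
  approximable (talpha j) x y -> approximable (talpha j) x' y'.
Proof.
move=> B e0; set e := _ + _ in e0 *; set e' := lpoly A + _ * w.
move=> ed e'd B0d x'E y'E [Q [P [Q0 Qx QP]]].
set f := _ - _ in QP.
have f0 : f != 0 by rewrite subr_eq0 irrational_theta.
pose Q' := (A + B) * Q - Q * B * ('X + 1) - ('X + 1) ^+ 3 * B0 * P.
pose P' := (A + B) * P - Q * 'X^j ^+ 2 * B0.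
have ef : e * f = lpoly Q' * talpha j - lpoly P'.
  have := alpha_quad; rewrite /e /f /Q' /P' /B /zeta; move: thue_morse_series => a.
  rewrite !(lpolyX, lpolyB, lpolyD, lpolyM, lpoly1).
  set t1 := lpoly 'X; set b := lpoly B0; set q := lpoly Q => H.
  rewrite -[LHS]addr0.
  have <- : q * t1 ^+ j ^+ 2 * b * (1 - ((t1 + 1) ^+ 3 * a ^+ 2 + (t1 + 1) ^+ 2 * a)) = 0.
    by rewrite H subrr mulr0.
  by ring.
have Q'E : lpoly Q' = lpoly Q * e' + f * lpoly (('X + 1) ^+ 3 * B0).
  rewrite /e' /f /Q' /B /zeta; move: thue_morse_series => a.
  rewrite !(lpolyX, lpolyB, lpolyD, lpolyM, lpoly1).
  set t1 := lpoly 'X; set b := lpoly B0; set q := lpoly Q.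
  apply: (@eql2 _ _ (- (q * (t1 + 1) * t1 ^+ j * b * ((t1 + 1) + (t1 + 1) ^+ 2 * a)))).
  by ring.
have efd : ldeg_le (e * f) (- y'.+1%:Z).
  have -> : - y'.+1%:Z = - p + - y.+1%:Z by lia.
  by apply: ldeg_leM => //; rewrite ldeg_leE // ed.
exists Q', P'; rewrite -ef; split=> //.
  (* Otherwise e f would be a nonzero polynomial of negative degree. *)
  apply/eqP => Q'0; move: ef; rewrite Q'0 lpoly0 mul0r sub0r => efP.
  have := mulf_neq0 e0 f0; rewrite efP oppr_eq0 lpoly_eq0 => /eqP[].
  apply: lpoly_lt0; rewrite -[lpoly _]opprK -efP; apply: ldeg_leN.
  by apply: ldeg_leW efd; lia.
apply/ldeg_le_lpoly; rewrite Q'E x'E; apply: ldeg_leD.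
  apply: ldeg_leM; first exact/ldeg_le_lpoly.
  have [->//|e'0] := eqVneq e' 0; rewrite ldeg_leE // e'd //.
have -> : x%:Z + p = - y.+1%:Z + (p + x%:Z + y.+1%:Z) by ring.
exact: ldeg_leM.
Qed.

(** The previous lemma for e = z^p and for its inverse e = w^p. *)
Lemma approximable_periodic i j x y : (0 < i)%N -> (j <= 2 ^ i.+1)%N ->
  approximable (talpha j) (x + 3 * 2 ^ i) (y + 3 * 2 ^ i) <->
  approximable (talpha j) x y.
Proof.
move=> i0 ji; have [C HC] := root_pow3 i; set p := (3 * 2 ^ i)%N in HC *.
have i2 : (2 <= 2 ^ i)%N by rewrite -[X in (X <= _)%N]expn1 leq_exp2l.
pose B0 : {poly 'F_2} := ('X + 1) ^+ (2 ^ i - 2) * 'X^(2 ^ i.+1 - j).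
have BE : lpoly (('X + 1) * 'X^j * B0) = s ^+ (2 ^ i).-1 * t ^+ (2 ^ i.+1).
  rewrite /B0 !(lpolyM, lpolyX); set x1 := lpoly ('X + 1).
  have -> : (2 ^ i).-1 = (2 ^ i - 2).+1 by lia.
  by rewrite -{2}(subnK ji) exprD exprS; ring.
have B0d : ldeg (lpoly (('X + 1) ^+ 3 * B0)) = p%:Z + 1 - j%:Z.
  rewrite /B0 !(lpolyM, lpolyX) !ldegM ?mulf_neq0 ?expf_neq0 ?s_neq0 ?t_neq0 //.
  rewrite !ldeg_s ldeg_sX ldeg_tX /p; move: i2 ji; rewrite expnS.
  by move: (2 ^ i)%N => k; lia.
have B00 : lpoly (('X + 1) ^+ 3 * B0) != 0.
  by rewrite /B0 !(lpolyM, lpolyX) ?mulf_neq0 ?expf_neq0 ?s_neq0 ?t_neq0.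
have zE := HC z zeta_quad; have wE := HC w zeta_conj_quad; rewrite -BE in zE wE.
split.
  have wE' : w ^+ p = lpoly (C + ('X + 1) * 'X^j * B0 * ('X + 1)) +
      lpoly (('X + 1) * 'X^j * B0) * z.
    by rewrite wE (lpolyD C) (lpolyM (_ * B0)); ring.
  have zE' : z ^+ p = lpoly (C + ('X + 1) * 'X^j * B0 * ('X + 1)) +
      lpoly (('X + 1) * 'X^j * B0) * w.
    rewrite zE (lpolyD C) (lpolyM (_ * B0)); set b := lpoly (_ * B0).
    by apply: (@eql2 _ _ (- (b * s))); ring.
  apply: (@approximable_shift _ (C + ('X + 1) * 'X^j * B0 * ('X + 1)) B0 (- p%:Z)); last 2 first.
  - by lia.
  - by lia.
  - by rewrite -wE' expf_neq0 ?zetac_neq0.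
  - by rewrite -wE' ldeg_zetacX opprK.
  - by rewrite -zE' ldeg_zetaX.
  by rewrite ldeg_leE // B0d; lia.
apply: (@approximable_shift _ C B0 p%:Z); last 2 first.
- by lia.
- by lia.
- by rewrite -zE expf_neq0 ?zeta_neq0.
- by rewrite -zE ldeg_zetaX.
- by rewrite -wE ldeg_zetacX.
by rewrite ldeg_leE // B0d; lia.
Qed.

(** Since t^(2^(i+1)) s^(2^i - 1) is the coefficient of z in z^(3 * 2^i), the power
    t^b z^(3 * 2^i) has the form Q t^j alpha - P with Q = s^(2^i + 1) t^a.
    One of a and b can be taken to be 0, according to whether j <= 2^(i+1) or not. *)
Lemma approximable_window i j a b x y : (a + j = b + 2 ^ i.+1)%N ->
    (2 ^ i + a < x)%N -> (y + b < 3 * 2 ^ i)%N ->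
  approximable (talpha j) x y.
Proof.
move=> aj xi yi; have [C HC] := root_pow3 i; have zE := HC z zeta_quad.
pose B : {poly 'F_2} := ('X + 1) ^+ (2 ^ i).-1 * 'X^(2 ^ i.+1).
have BE : lpoly B = s ^+ (2 ^ i).-1 * t ^+ (2 ^ i.+1) by rewrite lpolyM !lpolyX.
have sE : s ^+ (2 ^ i).+1 = s ^+ (2 ^ i).-1 * s ^+ 2.
  by rewrite -exprD addn2 prednK // expn_gt0.
pose Q : {poly 'F_2} := ('X + 1) ^+ (2 ^ i).+1 * 'X^a.
have QE : lpoly Q = s ^+ (2 ^ i).+1 * t ^+ a by rewrite lpolyM !lpolyX.
have Q0 : lpoly Q != 0 by rewrite QE mulf_neq0 ?expf_neq0 ?s_neq0 ?t_neq0.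
exists Q, (- ('X^b * (C + B))); split.
- by rewrite -lpoly_eq0.
- apply/ldeg_le_lpoly; rewrite ldeg_leE // QE.
  by rewrite ldegM ?expf_neq0 ?s_neq0 ?t_neq0 // ldeg_sX ldeg_tX; lia.
have -> : lpoly Q * talpha j - lpoly (- ('X^b * (C + B))) = t ^+ b * z ^+ (3 * 2 ^ i).
  rewrite lpolyN opprK zE lpolyM lpolyD lpolyX BE QE sE /zeta.
  transitivity (s ^+ (2 ^ i).-1 * s ^+ 2 * (t ^+ (a + j)) * alpha +
      t ^+ b * (lpoly C + s ^+ (2 ^ i).-1 * t ^+ (2 ^ i.+1))).
    by rewrite exprD; ring.
  by rewrite aj exprD; ring.
rewrite ldeg_leE ?mulf_neq0 ?expf_neq0 ?t_neq0 ?zeta_neq0 //.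
by rewrite ldegM ?expf_neq0 ?t_neq0 ?zeta_neq0 // ldeg_tX ldeg_zetaX; lia.
Qed.

(** * Small partial quotients when j is a power of 2 *)

Lemma root_pow n : exists C V : {poly 'F_2}, forall r : laurent 'F_2,
  r ^+ 2 = s * r + 1 -> r ^+ n = lpoly C + lpoly V * r.
Proof.
elim: n => [|n [C [V IHn]]].
  by exists 1, 0 => r _; rewrite lpoly1 lpoly0 mul0r addr0.
exists V, (C + ('X + 1) * V) => r r2.
by rewrite exprS (IHn _ r2) (lpolyD C) (lpolyM (_ + _)) mulrDr mulrCA -expr2 r2; ring.
Qed.

Lemma s_pow2 m : s ^+ (2 ^ m) = t ^+ (2 ^ m) + 1.
Proof.
elim: m => [|m IHm]; first by rewrite !expr1 lpolyD lpoly1.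
rewrite expnSr !exprM IHm; apply: (@eql2 _ _ (t ^+ (2 ^ m))); ring.
Qed.

(** The form is f = z^n + z^N (z^n + w^n) with N = 2^m. Writing z^n = C + V z, it
    is C + V z + V s z^N, and z^N = A + s^(N-1) z, so the coefficient of z in f is
    V (1 + s^N) = V t^N. *)
Lemma central_form m n : (0 < n)%N -> (n.*2 < 2 ^ m)%N -> exists Q P,
  let f := lpoly Q * talpha (2 ^ m) - lpoly P in
  [/\ lpoly Q != 0, ldeg (lpoly Q) = n.+1%:Z, f != 0 & ldeg f = - n%:Z].
Proof.
move=> n0 nm; have [C [V HV]] := root_pow n.
have [|A HA] := @root_pow2 1 0 1 m.
  by move=> r _; rewrite lpoly0 lpoly1 add0r mul1r expr1.
have zn := HV z zeta_quad; have wn := HV w zeta_conj_quad.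
have := HA z zeta_quad; rewrite mul1n lpoly1 expr1n mulr1 => zN.
have Vs : lpoly V * s = w ^+ n + z ^+ n.
  by apply: (@eql2 _ _ (- (lpoly C + lpoly V * z))); rewrite zn wn; ring.
have [Vs0 Vsd] : lpoly V * s != 0 /\ ldeg (lpoly V * s) = n%:Z.
  rewrite Vs -ldeg_zetacX; apply: (@ldegDl _ _ _ (- n%:Z)).
  - by rewrite expf_neq0 ?zetac_neq0.
  - by rewrite ldeg_leE ?expf_neq0 ?zeta_neq0 // ldeg_zetaX.
  by rewrite ldeg_zetacX; lia.
have V0 : lpoly V != 0 by apply: contraNneq Vs0 => ->; rewrite mul0r.
have Vd : ldeg (lpoly V) + 1 = n%:Z by rewrite -ldeg_s -ldegM ?s_neq0.
exists (V * ('X + 1) ^+ 2), (- (C + V * ('X + 1) * A + V * 'X^(2 ^ m))).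
move=> f; have fE : f = z ^+ n + z ^+ (2 ^ m) * (z ^+ n + w ^+ n).
  rewrite [z ^+ n + w ^+ n]addrC -Vs zN zn /f lpolyN opprK.
  rewrite (lpolyD (C + _)) (lpolyD C) (lpolyM V (_ ^+ 2)) !(lpolyM _ A).
  rewrite (lpolyM V ('X + 1)) (lpolyM V) !lpolyX.
  have -> : t ^+ (2 ^ m) = s * s ^+ (2 ^ m).-1 + 1.
    rewrite -exprS prednK ?expn_gt0 // s_pow2.
    by apply: (@eql2 _ _ (- 1)); ring.
  by rewrite /zeta; ring.
have fE2 : f = z ^+ n + (z ^+ (2 ^ m) * z ^+ n + z ^+ (2 ^ m - n)).
  have nN : (n <= 2 ^ m)%N by lia.
  rewrite fE mulrDr -{2}(subnK nN).
  by rewrite [z ^+ (_ + n)]exprD -[_ * w ^+ n]mulrA -exprMn zetaV expr1n mulr1.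
have [f0 fd] : f != 0 /\ ldeg f = - n%:Z.
  rewrite fE2 -ldeg_zetaX; apply: (@ldegDl _ _ _ (- n.+1%:Z)).
  - by rewrite expf_neq0 ?zeta_neq0.
  - rewrite -exprD; apply: ldeg_leD; rewrite ldeg_leE ?expf_neq0 ?zeta_neq0 //.
      by rewrite ldeg_zetaX; lia.
    by rewrite ldeg_zetaX; lia.
  by rewrite ldeg_zetaX; lia.
split=> //; first by rewrite lpolyM lpolyX mulf_neq0 ?expf_neq0 ?s_neq0.
by rewrite lpolyM lpolyX ldegM ?expf_neq0 ?s_neq0 // ldeg_sX [RHS]intS -Vd addrCA.
Qed.

(** A form f with denominator of degree at most x and degree below -(x + 3) is
    proportional to the central forms for n = x + 1 and n = x + 2, a polynomial of
    negative degree being 0. Proportionality forces deg Q = deg f + 2 n + 1, which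
    cannot hold for both values of n. *)
Lemma not_approximable m x : (x.*2 + 4 < 2 ^ m)%N ->
  ~ approximable (talpha (2 ^ m)) x (x + 3).
Proof.
move=> xm [Q [P [Q0 Qx QP]]]; set f := _ - _ in QP.
have Q0' : lpoly Q != 0 by rewrite lpoly_eq0.
have f0 : f != 0 by rewrite subr_eq0 irrational_theta.
have fd : ldeg f <= - (x + 3).+1%:Z by rewrite -ldeg_leE.
have Qd : ldeg (lpoly Q) <= x%:Z by rewrite -ldeg_leE //; apply/ldeg_le_lpoly.
have degE n : (x < n)%N -> (n <= x + 2)%N -> ldeg (lpoly Q) = ldeg f + n.*2.+1%:Z.
  move=> xn nx; have [||Q1 [P1 [Q10 Q1d f10 f1d]]] := @central_form m n; [lia|lia|].
  set f1 := _ - _ in f10 f1d.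
  suff E : lpoly Q1 * f = lpoly Q * f1.
    have := congr1 ldeg E; rewrite !ldegM // f1d Q1d; lia.
  have E : lpoly (Q * P1 - P * Q1) = lpoly Q1 * f - lpoly Q * f1.
    by rewrite /f /f1 lpolyB !lpolyM; ring.
  apply/eqP; rewrite -subr_eq0 -E lpoly_eq0; apply/eqP/lpoly_lt0; rewrite E.
  by apply: ldeg_leB; rewrite ldeg_leE ?mulf_neq0 // ldegM //; lia.
have := degE x.+1; have := degE x.+2; lia.
Qed.

(** * Counting over one period *)

Lemma sum_interval a b n :
  (\sum_(0 <= x < n) (a <= x < b) = minn n b - a)%N.
Proof.
elim: n => [|n IHn]; first by rewrite big_geq // min0n.
by rewrite big_nat_recr //= IHn; lia.
Qed.

(** With h = 2^(i-1) the period is 6h and 2h < j <= 4h. The powers z^(6h) and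
    z^(3h) give windows in ]6h - j, 6h[ and ]h, 5h - j[, which are disjoint. *)
Lemma gap_count_ge i j d : (0 < i)%N -> (2 ^ i < j <= 2 ^ i.+1)%N ->
  (2 ^ i.+1 <= gap_count (talpha j) d (3 * 2 ^ i) + d.*2 + 2)%N.
Proof.
case: i => // i _ /andP[ij ji]; set n := (3 * 2 ^ i.+1)%N.
have n2 : n = (6 * 2 ^ i)%N by rewrite /n expnS; lia.
pose f x := ((6 * 2 ^ i - j).+1 <= x < 6 * 2 ^ i - d)%N.
pose g x := ((2 ^ i).+1 <= x < 5 * 2 ^ i - j - d)%N.
have le_fg : (\sum_(0 <= x < n) f x + \sum_(0 <= x < n) g x <=
              gap_count (talpha j) d n)%N.
  rewrite -big_split /=; apply: leq_sum => x _.
  have jb : (j <= 4 * 2 ^ i)%N by move: ji; rewrite !expnS; lia.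
  have ja : (2 * 2 ^ i < j)%N by move: ij; rewrite expnS.
  case: (boolP (f x)) => [/andP[xa xb]|_].
    have -> : g x = false.
      apply/negbTE; move: xa xb ja jb; rewrite /g; move: (2 ^ i)%N => h; lia.
    rewrite addn0 lt0b; apply/asboolP.
    apply: (@approximable_window i.+1 _ (2 ^ i.+2 - j) 0); first by lia.
      by move: xa; rewrite !expnS; lia.
    by move: xb; rewrite !expnS; lia.
  case: (boolP (g x)) => [/andP[xa xb]|//]; rewrite lt0b; apply/asboolP.
  apply: (@approximable_window i _ 0 (j - 2 ^ i.+1)); [lia|lia|].
  by move: xb ij; rewrite !expnS; lia.
apply: leq_trans (_ : _ <= \sum_(0 <= x < n) f x + \sum_(0 <= x < n) g x + d.*2 + 2)%N _.
  rewrite !sum_interval n2; move: ij ji; rewrite !expnS.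
  by move: (2 ^ i)%N => h; lia.
by rewrite !leq_add2r.
Qed.

(** Outside the last 2^(i+1) + 2 degrees of the period, no gap exceeds 3. *)
Lemma gap_count_le i d : (2 < d)%N ->
  (gap_count (talpha (2 ^ i.+1)) d (3 * 2 ^ i) <= 2 ^ i.+1 + 2)%N.
Proof.
move=> d3; apply: leq_trans (_ : _ <= \sum_(0 <= x < 3 * 2 ^ i)
    (2 ^ i - 2 <= x < 3 * 2 ^ i))%N _; last first.
  by rewrite sum_interval minnn expnS; move: (2 ^ i)%N => h; lia.
rewrite /gap_count big_nat [leqRHS]big_nat; apply: leq_sum => x /andP[_ xn].
rewrite xn andbT; case: (leqP (2 ^ i - 2) x) => [_|xi]; first exact: leq_b1.
rewrite leqn0 eqb0; apply/asboolP => /(@approximableW _ _ _ _ (x + 3)) ax.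
by apply: (@not_approximable i.+1 x); [rewrite expnS; lia | apply: ax; lia].
Qed.

(** * The mass as a density *)

Section MassLimit.
Context {R : realType} {F : fieldType}.
Variables (th : laurent F) (p : nat).
Hypothesis th_irr : irrational th.
Hypothesis p_gt0 : (0 < p)%N.
Hypothesis th_periodic :
  forall x y, approximable th (x + p) (y + p) <-> approximable th x y.

Lemma gap_countD d n : gap_count th d (n + p) = (gap_count th d n + gap_count th d p)%N.
Proof.
rewrite /gap_count addnC (@big_cat_nat _ _ _ p) ?leq_addr //= addnC; congr (_ + _)%N.
rewrite -{1}[p]add0n big_addn addKn; apply: eq_bigr => x _; congr nat_of_bool.
by apply: asbool_equiv_eq; rewrite addnAC th_periodic.
Qed.

Lemma gap_count_le_n d n : (gap_count th d n <= n)%N.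
Proof.
rewrite /gap_count -[X in (_ <= X)%N](subn0 n) -[X in (_ <= X)%N]muln1.
by rewrite -sum_nat_const_nat; apply: leq_sum => x _; apply: leq_b1.
Qed.

(** Both counts are affine in the number of full periods, so only the last,
    incomplete period contributes to the difference. *)
Lemma gap_count_density d n : (0 < n)%N ->
  `|(gap_count th d p)%:R / p%:R - (gap_count th d n)%:R / n%:R| <= p%:R / n%:R :> R.
Proof.
move=> n0; set c := gap_count th d p; pose r := (n %% p)%N.
have nE : gap_count th d n = (n %/ p * c + gap_count th d r)%N.
  rewrite {1}(divn_eq n p); elim: (n %/ p)%N => // k IHk.
  by rewrite mulSn -addnA [(p + _)%N]addnC gap_countD IHk mulSn -/c; lia.
have rp : (r <= p)%N by rewrite ltnW // ltn_pmod.
have p0 : p%:R != 0 :> R by rewrite pnatr_eq0 -lt0n.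
have n0' : n%:R != 0 :> R by rewrite pnatr_eq0 -lt0n.
have -> : c%:R / p%:R - (gap_count th d n)%:R / n%:R =
    ((c * r)%:R - (p * gap_count th d r)%:R) / p%:R / n%:R :> R.
  rewrite nE; have nR : n%:R = (n %/ p)%:R * p%:R + r%:R :> R.
    by rewrite -natrM -natrD -divn_eq.
  rewrite natrD !natrM; move: n0'; rewrite nR => n0'; field.
  by rewrite p0 n0'.
rewrite normrM [`|n%:R^-1|]ger0_norm ?invr_ge0 //.
rewrite ler_pM2r ?invr_gt0 ?ltr0n //.
rewrite normrM [`|p%:R^-1|]ger0_norm ?invr_ge0 // ler_pdivrMr ?ltr0n // -natrM.
have h1 : (c * r)%:R <= (p * p)%:R :> R.
  by rewrite ler_nat leq_mul // gap_count_le_n.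
have h2 : (p * gap_count th d r)%:R <= (p * p)%:R :> R.
  by rewrite ler_nat leq_mul // (leq_trans _ rp) // gap_count_le_n.
have h3 := ler0n R (c * r); have h4 := ler0n R (p * gap_count th d r).
by rewrite ler_norml; lra.
Qed.

Lemma cf_mass_nat d k : cf_mass th (d%:R : R) k =
  (gap_count th d (\sum_(1 <= i < k.+1) cf_deg th i))%:R /
  (\sum_(1 <= i < k.+1) cf_deg th i)%:R.
Proof.
rewrite -sum_gaps // !natr_sum /cf_mass; congr (_ / _); apply: eq_bigr => i _.
case: (leqP d (cf_deg th i)) => [di|id].
  by rewrite natrB // max_l // subr_ge0 ler_nat.
by rewrite max_r ?subr_le0 ?ler_nat ?(ltnW id) // (eqP (ltnW id)).
Qed.

Lemma cvg_cf_mass_nat d :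
  cf_mass th (d%:R : R) k @[k --> \oo] --> ((gap_count th d p)%:R / p%:R : R).
Proof.
apply/cvgrPdist_le => e e0; near=> k.
rewrite cf_mass_nat; set n := (\sum_(_ <= _ < _) _)%N.
have kn : (k <= n)%N by exact: leq_sum_cf_deg.
have k0 : (0 < k)%N by near: k; exact: nbhs_infty_gt.
apply: le_trans (gap_count_density d (leq_trans k0 kn)) _.
rewrite ler_pdivrMr ?ltr0n ?(leq_trans k0 kn) // mulrC -ler_pdivrMr //.
apply: le_trans (_ : k%:R <= _); last by rewrite ler_nat.
by near: k; exact: nbhs_infty_ger.
Unshelve. all: by end_near. Qed.

(** As a function of the threshold, (g - d)^+ is affine between consecutive
    integers because its only break point g is an integer. *)
Lemma max_interpolate (g n : nat) (l : R) : 0 <= l <= 1 ->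
  Num.max (g%:R - (n%:R + l)) 0 =
  (1 - l) * Num.max (g%:R - n%:R) 0 + l * Num.max (g%:R - n.+1%:R) 0.
Proof.
move=> /andP[l0 l1]; rewrite -[n.+1]addn1 natrD.
case: (leqP g n) => [gn|ng].
  have : g%:R <= n%:R :> R by rewrite ler_nat.
  by move=> ?; rewrite !max_r ?mulr0 ?addr0 //; lra.
have : n%:R + 1 <= g%:R :> R by rewrite natr1 ler_nat.
by move=> ?; rewrite !max_l //; lra.
Qed.

Lemma cvg_cf_mass (d : R) : 0 <= d ->
  exists2 l : R, 0 <= l <= 1 & cf_mass th d k @[k --> \oo] -->
    ((1 - l) * ((gap_count th (Num.truncn d) p)%:R / p%:R) +
     l * ((gap_count th (Num.truncn d).+1 p)%:R / p%:R)).
Proof.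
move=> d0; have /andP[nd dn] := truncn_itv d0; set n := Num.truncn d in nd dn *.
have l01 : 0 <= d - n%:R <= 1.
  by move: dn; rewrite -[n.+1]addn1 natrD => dn; apply/andP; split; lra.
exists (d - n%:R) => //.
have -> : cf_mass th d = fun k => (1 - (d - n%:R)) * cf_mass th n%:R k +
                                  (d - n%:R) * cf_mass th n.+1%:R k.
  apply/funext => k; rewrite /cf_mass !mulrA -mulrDl !mulr_sumr -big_split /=.
  congr (_ / _); apply: eq_bigr => i _; rewrite -max_interpolate //.
  by rewrite [n%:R + _]addrC subrK.
by apply: cvgD; apply: cvgMr; exact: cvg_cf_mass_nat.
Qed.

End MassLimit.

(** * The limit inferior *)

Section ThueMorseMass.
Context {R : realType}.

Lemma cvg_mass_theta i j (d : R) : (0 < i)%N -> (j <= 2 ^ i.+1)%N -> 0 <= d ->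
  exists2 l : R, 0 <= l <= 1 & cf_mass (talpha j) d k @[k --> \oo] -->
    ((1 - l) * ((gap_count (talpha j) (Num.truncn d) (3 * 2 ^ i))%:R / (3 * 2 ^ i)%:R) +
     l * ((gap_count (talpha j) (Num.truncn d).+1 (3 * 2 ^ i))%:R / (3 * 2 ^ i)%:R)).
Proof.
move=> i0 ji d0; apply: cvg_cf_mass => //; first exact: irrational_theta.
  by rewrite muln_gt0 expn_gt0.
by move=> x y; apply: approximable_periodic.
Qed.

Lemma is_cvg_mass_theta j (d : R) : 0 <= d ->
  cvgn (fun k => cf_mass (talpha j) d k).
Proof.
move=> d0; have ji : (j <= 2 ^ j.+2)%N.
  by apply: ltnW; apply: leq_trans (ltn_expl j (ltnSn 1)) _; rewrite leq_exp2l // leqW.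
by have [l _ /cvgP] := cvg_mass_theta (ltn0Sn j) ji d0.
Qed.

Lemma mass_theta_ge i j (d : R) : (0 < i)%N -> (2 ^ i < j <= 2 ^ i.+1)%N -> 0 <= d ->
  2 / 3 - (2 * (Num.truncn d)%:R + 4) / (3 * 2 ^ i)%:R <=
  limn (fun k => cf_mass (talpha j) d k).
Proof.
move=> i0 ij d0; have /andP[_ ji] := ij; set n := Num.truncn d.
have [l /andP[l0 l1] /cvg_lim ->//] := cvg_mass_theta i0 ji d0.
have P0 : 0 < (3 * 2 ^ i)%:R :> R by rewrite ltr0n muln_gt0 expn_gt0.
have key m : (m <= n.+1)%N -> 2 / 3 - (2 * n%:R + 4) / (3 * 2 ^ i)%:R <=
    (gap_count (talpha j) m (3 * 2 ^ i))%:R / (3 * 2 ^ i)%:R :> R.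
  move=> mn; have := @gap_count_ge i j m i0 ij; set c := gap_count _ _ _ => cm.
  rewrite ler_pdivlMr // mulrBl divfK ?gt_eqF //.
  have : (2 * 2 ^ i)%:R <= (c + n.*2 + 4)%:R :> R.
    by rewrite ler_nat; move: cm; rewrite expnS; lia.
  rewrite -mul2n !natrM (natrD _ (_ + _)) (natrD _ c) natrM; lra.
have := key n (leqnSn n); have := key n.+1 (leqnn _).
rewrite -/n; set A := _ / _ in l0 l1 *; set B := (gap_count _ n _)%:R / _; nra.
Qed.

Lemma mass_theta_le i (d : R) : (0 < i)%N -> 3 <= d ->
  limn (fun k => cf_mass (talpha (2 ^ i.+1)) d k) <= 2 / 3 + 2 / (3 * 2 ^ i)%:R.
Proof.
move=> i0 d3; have d0 : 0 <= d by lra.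
set n := Num.truncn d.
have n3 : (2 < n)%N by rewrite truncn_gt_nat.
have [l /andP[l0 l1] /cvg_lim ->//] := cvg_mass_theta i0 (leqnn _) d0.
have P0 : 0 < (3 * 2 ^ i)%:R :> R by rewrite ltr0n muln_gt0 expn_gt0.
have key m : (2 < m)%N ->
    (gap_count (talpha (2 ^ i.+1)) m (3 * 2 ^ i))%:R / (3 * 2 ^ i)%:R <=
    2 / 3 + 2 / (3 * 2 ^ i)%:R :> R.
  move=> m3; have := @gap_count_le i m m3; set c := gap_count _ _ _ => cm.
  rewrite ler_pdivrMr // mulrDl divfK ?gt_eqF //.
  have : c%:R <= (2 * 2 ^ i + 2)%:R :> R by rewrite ler_nat -expnS.
  rewrite natrD !natrM; lra.
have := key n n3; have := key n.+1 (ltnW n3).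
rewrite -/n; set A := (_ / (3 * 2 ^ i)%:R) in l0 l1 *; nra.
Qed.

End ThueMorseMass.

Lemma limn_einf_eq (R : realType) (u : R^nat) (l : R) :
    (forall e, 0 < e -> \forall j \near \oo, l - e <= u j) ->
    (forall e n, 0 < e -> exists2 j, (n <= j)%N & u j <= l + e) ->
  limn_einf (fun j => (u j)%:E) = l%:E.
Proof.
move=> ul lu; rewrite limn_einf_lim.
have /cvg_lim -> // := @cvg_einfs_sup _ (fun j => (u j)%:E).
apply/eqP; rewrite eq_le; apply/andP; split.
  apply: ge_ereal_sup => _ [n _ <-]; apply/lee_addgt0Pr => e e0.
  have [j nj ujl] := lu e n e0; apply: le_trans (_ : (u j)%:E <= _)%E.
    by apply: ereal_inf_lbound; exists j.
  by rewrite -EFinD lee_fin.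
apply/lee_subgt0Pr => e e0; have [N _ uN] := ul e e0.
apply: le_trans (_ : einfs (fun j => (u j)%:E) N <= _)%E; last first.
  by apply: ereal_sup_ubound; exists N.
by apply: le_ereal_inf_tmp => _ [j /= Nj <-]; rewrite -EFinB lee_fin; apply: uN.
Qed.

Theorem theorem1p2 (R : realType) :
  let theta (j : nat) : laurent 'F_2 := lpoly 'X ^+ j * thue_morse_series in
  (forall (d : R) (j : nat), 0 < d ->
     cvgn (fun k : nat => cf_mass (theta j) d k)) /\
  limn_einf (fun j : nat =>
    (limn (fun k : nat => cf_mass (theta j) d k))%:E) @[d --> (+oo : set_system R)]
    --> (2 / 3 : R)%:E.
Proof.
split=> [d j d0|]; first exact/is_cvg_mass_theta/ltW.
apply: cvg_near_cst; near=> d.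
have d3 : 3 <= d by near: d; apply: nbhs_pinfty_ge; rewrite num_real.
have d0 : 0 <= d by lra.
apply: limn_einf_eq => [e e0|e n e0].
  near=> j; set n := Num.truncn d.
  have j2 : (2 < j)%N by near: j; exact: nbhs_infty_gt.
  have [i i0 ij] : exists2 i, (0 < i)%N & (2 ^ i < j <= 2 ^ i.+1)%N.
    exists (trunc_log 2 j.-1); first by rewrite trunc_log_gt0; lia.
    have := @trunc_log_bounds 2 j.-1 isT; lia.
  apply: le_trans (mass_theta_ge i0 ij d0); rewrite lerB //.
  have P0 : 0 < (3 * 2 ^ i)%:R :> R by rewrite ltr0n muln_gt0 expn_gt0.
  rewrite ler_pdivrMr // [e * _]mulrC -ler_pdivrMr //.
  apply: le_trans (_ : j%:R <= _); first by near: j; exact: nbhs_infty_ger.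
  by rewrite ler_nat; move: ij; rewrite expnS; lia.
(* 2^i has to exceed both n and 2 / e. *)
pose i := (n + Num.truncn (2 / e)).+1.
exists (2 ^ i.+1)%N.
  by apply: ltnW; apply: leq_trans (ltn_expl _ (ltnSn 1)); rewrite /i; lia.
apply: le_trans (mass_theta_le (ltn0Sn _) d3) _; rewrite lerD2l.
have P0 : 0 < (3 * 2 ^ i)%:R :> R by rewrite ltr0n muln_gt0 expn_gt0.
rewrite ler_pdivrMr // [e * _]mulrC -ler_pdivrMr //.
apply: le_trans (ltW (truncnS_gt _)) _; rewrite ler_nat.
apply: leq_trans (_ : 2 ^ i <= _)%N; last exact: leq_pmull.
by apply: ltn_trans (ltn_expl i (ltnSn 1)); rewrite ltnS leq_addl.
Unshelve. all: by end_near. Qed.
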